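(* Let $G$ and $H$ be nilpotent groups of nilpotency class $n$ acting on each other. If the mutual actions are compatible, then the non-abelian tensor product $G\otimes H$ is a nilpotent group of class at most $n$.
   Context: Groups act on themselves by conjugation on the left: ${}^{g}g'=gg'g^{-1}$. Let $G$ act on $H$ and $H$ act on $G$ by automorphisms (left actions, written ${}^{g}h$ and ${}^{h}g$). The mutual actions are compatible if ${}^{({}^{h}g)}h'={}^{hgh^{-1}}h'$ and ${}^{({}^{g}h)}g'={}^{ghg^{-1}}g'$ for all $g,g'\in G$, $h,h'\in H$, where ${}^{hgh^{-1}}h'$ means $h\cdot {}^{g}(h^{-1}h'h)\cdot h^{-1}$ and ${}^{ghg^{-1}}g'$ means $g\cdot {}^{h}(g^{-1}g'g)\cdot g^{-1}$. For compatible actions, the non-abelian tensor product $G\otimes H$ is the group generated by symbols $g\otimes h$ ($g\in G$, $h\in H$) with relations $gg'\otimes h=({}^{g}g'\otimes {}^{g}h)(g\otimes h)$ and $g\otimes hh'=(g\otimes h)({}^{h}g\otimes {}^{h}h')$ for all $g,g'\in G$, $h,h'\in H$. *)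

(* Defs.v *)
From HB Require Import structures.
From mathcomp Require Import all_boot.
From mathcomp Require Import boolp.

Set Implicit Arguments.
Unset Strict Implicit.
Unset Printing Implicit Defensive.

Local Open Scope quotient_scope.
Local Open Scope group_scope.

(* Groups are arbitrary, possibly infinite, [groupType]s.  The [choiceType]
   structure that this includes exists classically on every type. *)

(* The group presented by generators X and relations u = v for R u v.  Words
   are sequences of letters (b, x), standing for x if b = false and for x^-1
   if b = true. *)
Section Presentation.

Variables (X : choiceType) (R : seq (bool * X) -> seq (bool * X) -> Prop).

Inductive pres_eq : seq (bool * X) -> seq (bool * X) -> Prop :=
| pres_eq_refl u : pres_eq u u
| pres_eq_sym u v : pres_eq u v -> pres_eq v u
| pres_eq_trans u v w : pres_eq u v -> pres_eq v w -> pres_eq u w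
| pres_eq_cat u u' v v' :
    pres_eq u u' -> pres_eq v v' -> pres_eq (u ++ v) (u' ++ v')
| pres_eq_cancel b x : pres_eq [:: (b, x); (~~ b, x)] [::]
| pres_eq_rel u v : R u v -> pres_eq u v.

Definition pres_eqb : rel (seq (bool * X)) := fun u v => `[< pres_eq u v >].

Fact pres_eqb_refl : reflexive pres_eqb.
Proof. by move=> u; apply/asboolP; apply: pres_eq_refl. Qed.

Fact pres_eqb_sym : symmetric pres_eqb.
Proof. by move=> u v; apply/asboolP/asboolP; apply: pres_eq_sym. Qed.

Fact pres_eqb_trans : transitive pres_eqb.
Proof.
by move=> v u w /asboolP uv /asboolP vw; apply/asboolP; apply: pres_eq_trans vw.
Qed.

Canonical pres_equiv :=
  EquivRel pres_eqb pres_eqb_refl pres_eqb_sym pres_eqb_trans.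

Definition presented : Type := {eq_quot pres_equiv}.

HB.instance Definition _ := Choice.on presented.
HB.instance Definition _ := EqQuotient.on presented.

Definition pres_class (u : seq (bool * X)) : presented := \pi_presented u.

Lemma pres_classP u v : pres_class u = pres_class v <-> pres_eq u v.
Proof.
split; first by move/eqP; rewrite piE => /asboolP.
by move=> uv; apply/eqP; rewrite piE; apply/asboolP.
Qed.

Lemma pres_classK (x : presented) : pres_class (repr x) = x.
Proof. exact: reprK. Qed.

Definition pres_inv_word (u : seq (bool * X)) : seq (bool * X) :=
  rev [seq (~~ a.1, a.2) | a <- u].

Definition pres_one : presented := pres_class [::].
Definition pres_mul (x y : presented) : presented :=
  pres_class (repr x ++ repr y).
Definition pres_inv (x : presented) : presented :=
  pres_class (pres_inv_word (repr x)).

Lemma pres_inv_wordl w : pres_eq (pres_inv_word w ++ w) [::].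
Proof.
elim: w => [|[b x] w IH]; first exact: pres_eq_refl.
rewrite /pres_inv_word /= rev_cons cat_rcons -/(pres_inv_word w).
apply: pres_eq_trans IH; apply: pres_eq_cat; first exact: pres_eq_refl.
rewrite -(cat1s _ w) -cat_cons -[X in pres_eq _ X]cat0s.
apply: pres_eq_cat (pres_eq_refl _).
by rewrite -{2}[b]negbK; apply: pres_eq_cancel.
Qed.

Lemma pres_inv_wordr w : pres_eq (w ++ pres_inv_word w) [::].
Proof.
have := pres_inv_wordl (pres_inv_word w).
rewrite {1}/pres_inv_word /pres_inv_word map_rev revK -map_comp.
rewrite (_ : map _ w = w) // -[RHS]map_id.
by apply: eq_map => -[b x] /=; rewrite negbK.
Qed.

Lemma pres_inv_word_eq u v :
  pres_eq u v -> pres_eq (pres_inv_word u) (pres_inv_word v).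
Proof.
move=> uv.
apply: (@pres_eq_trans _ (pres_inv_word u ++ (v ++ pres_inv_word v))).
  rewrite -[X in pres_eq X _]cats0.
  by apply: pres_eq_cat (pres_eq_refl _) (pres_eq_sym (pres_inv_wordr v)).
rewrite catA -[X in pres_eq _ X]cat0s.
apply: pres_eq_cat (pres_eq_refl _).
apply: pres_eq_trans (pres_inv_wordl u).
by apply: pres_eq_cat (pres_eq_refl _) (pres_eq_sym uv).
Qed.

Lemma pres_mul_class u v :
  pres_mul (pres_class u) (pres_class v) = pres_class (u ++ v).
Proof.
by apply/pres_classP; apply: pres_eq_cat; apply/pres_classP; apply: pres_classK.
Qed.

Lemma pres_inv_class u : pres_inv (pres_class u) = pres_class (pres_inv_word u).
Proof.
by apply/pres_classP; apply: pres_inv_word_eq; apply/pres_classP/pres_classK.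
Qed.

Fact pres_mulA : associative pres_mul.
Proof.
move=> x y z; rewrite -[x]pres_classK -[y]pres_classK -[z]pres_classK.
by rewrite !pres_mul_class catA.
Qed.

Fact pres_mul1 : left_id pres_one pres_mul.
Proof. by move=> x; rewrite -[x]pres_classK pres_mul_class. Qed.

Fact pres_mulr1 : right_id pres_one pres_mul.
Proof. by move=> x; rewrite -[x]pres_classK pres_mul_class cats0. Qed.

Fact pres_mulV : left_inverse pres_one pres_inv pres_mul.
Proof.
move=> x; rewrite -[x]pres_classK pres_inv_class pres_mul_class.
by apply/pres_classP; apply: pres_inv_wordl.
Qed.

Fact pres_mulrV : right_inverse pres_one pres_inv pres_mul.
Proof.
move=> x; have invK : pres_inv (pres_inv x) = x.
  by rewrite -[LHS]pres_mulr1 -(pres_mulV x) pres_mulA pres_mulV pres_mul1.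
by rewrite -[X in pres_mul X _]invK pres_mulV.
Qed.

HB.instance Definition _ := isGroup.Build presented
  pres_mulA pres_mul1 pres_mulr1 pres_mulV pres_mulrV.

Definition pres_gen (x : X) : presented := pres_class [:: (false, x)].

End Presentation.

Definition lconj (G : groupType) (g g' : G) : G := g * g' * g^-1.

(* A left action of K on L by automorphisms; bijectivity of [act k] follows
   from the first two axioms. *)
Record aut_action (K L : groupType) (act : K -> L -> L) : Prop := AutAction {
  aut_act1 : forall l, act 1 l = l;
  aut_actM : forall k k' l, act (k * k') l = act k (act k' l);
  aut_act_morph : forall k, {morph act k : l l' / l * l'}
}.

(* [aGH g h] is the action of g on h, and [aHG h g] that of h on g. *)
Definition compatible_actions (G H : groupType)
    (aGH : G -> H -> H) (aHG : H -> G -> G) : Prop :=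
  (forall (g : G) (h h' : H),
     aGH (aHG h g) h' = h * aGH g (h^-1 * h' * h) * h^-1) /\
  (forall (g g' : G) (h : H),
     aHG (aGH g h) g' = g * aHG h (g^-1 * g' * g) * g^-1).

Inductive tensor_rel (G H : groupType)
    (aGH : G -> H -> H) (aHG : H -> G -> G) :
    seq (bool * (G * H)) -> seq (bool * (G * H)) -> Prop :=
| tensor_rel_l (g g' : G) (h : H) :
    tensor_rel aGH aHG
      [:: (false, (g * g', h))]
      [:: (false, (lconj g g', aGH g h)); (false, (g, h))]
| tensor_rel_r (g : G) (h h' : H) :
    tensor_rel aGH aHG
      [:: (false, (g, h * h'))]
      [:: (false, (g, h)); (false, (aHG h g, lconj h h'))].

Definition tensor (G H : groupType)
    (aGH : G -> H -> H) (aHG : H -> G -> G) : groupType :=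
  presented (tensor_rel aGH aHG).

Definition tens (G H : groupType) (aGH : G -> H -> H) (aHG : H -> G -> G)
    (g : G) (h : H) : tensor aGH aHG :=
  pres_gen (tensor_rel aGH aHG) (g, h).

Lemma tensMl (G H : groupType) (aGH : G -> H -> H) (aHG : H -> G -> G)
    (g g' : G) (h : H) :
  tens aGH aHG (g * g') h =
    tens aGH aHG (lconj g g') (aGH g h) * tens aGH aHG g h.
Proof.
rewrite [RHS]pres_mul_class; apply/pres_classP/pres_eq_rel.
exact: tensor_rel_l.
Qed.

Lemma tensMr (G H : groupType) (aGH : G -> H -> H) (aHG : H -> G -> G)
    (g : G) (h h' : H) :
  tens aGH aHG g (h * h') =
    tens aGH aHG g h * tens aGH aHG (aHG h g) (lconj h h').
Proof.
rewrite [RHS]pres_mul_class; apply/pres_classP/pres_eq_rel.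
exact: tensor_rel_r.
Qed.

Inductive generated (G : groupType) (S : G -> Prop) : G -> Prop :=
| generated_in x : S x -> generated S x
| generated1 : generated S 1
| generatedM x y : generated S x -> generated S y -> generated S (x * y)
| generatedV x : generated S x -> generated S x^-1.

(* Indexed from 0: [@lower_central G n] is gamma_(n+1)(G). *)
Fixpoint lower_central (G : groupType) (n : nat) : G -> Prop :=
  if n is m.+1 then
    generated (fun z : G => exists x y : G, lower_central m x /\ z = [~ x, y])
  else fun _ => True.

Definition lower_central_trivial (G : groupType) (n : nat) : Prop :=
  forall x : G, lower_central n x -> x = 1.

(* G is nilpotent of nilpotency class exactly n. *)
Definition has_nil_class (G : groupType) (n : nat) : Prop :=
  lower_central_trivial G n /\
  forall m, lower_central_trivial G m -> (n <= m)%N.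

(* Main.v *)
Require Import Defs.
From mathcomp Require Import all_boot.
From mathcomp Require Import boolp.

(** Write [t = g ⊗ h] and let [a = g * (^h g)^-1] in [G] and
    [b = ^g h * h^-1] in [H] be its two boundaries.  Expanding
    [g g1 ⊗ h h1] in two ways by the defining relations shows that conjugation
    by [t] sends [g' ⊗ h'] to [^a g' ⊗ ^a h'] ([tens_conj]), and compatibility
    says that [a] acts on [H] as conjugation by [b] ([boundary_act]).  Both
    properties are inherited by products and inverses, so every [t] in the
    [k]-th term of the lower central series of [G ⊗ H] has such companions
    [a] and [b], lying in the [k]-th terms for [G] and [H]
    ([lower_central_boundary]).

    If [t] is in the last nontrivial term allowed by the class [n] of [G] and
    [H], then [a] and [b] are central.  So [^a g' = g'], and
    [^a h' = b h' b^-1 = h'], whence [t] commutes with every [g' ⊗ h'].  As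
    these generate, [t] is central and the next term vanishes.  Using [b] is
    what improves the bound [n + 1], given by the centrality of the kernel of
    the boundary map, to [n]. *)

Set Implicit Arguments.
Unset Strict Implicit.
Unset Printing Implicit Defensive.

Local Open Scope group_scope.

(** * Left conjugation and actions by automorphisms *)

Lemma lconjM (G : groupType) (x y z : G) : lconj (x * y) z = lconj x (lconj y z).
Proof. by rewrite /lconj invgM !mulgA. Qed.

Lemma lconj1 (G : groupType) (x : G) : lconj 1 x = x.
Proof. by rewrite /lconj mul1g invg1 mulg1. Qed.

Lemma lconjK (G : groupType) (x : G) : cancel (lconj x) (lconj x^-1).
Proof. by move=> y; rewrite -lconjM mulVg lconj1. Qed.

Lemma lconjVK (G : groupType) (x : G) : cancel (lconj x^-1) (lconj x).
Proof. by move=> y; rewrite -lconjM mulgV lconj1. Qed.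

Lemma lconj_id (G : groupType) (x y : G) : commute x y -> lconj x y = y.
Proof. by rewrite /lconj => ->; rewrite mulgK. Qed.

Lemma commute_lconj (G : groupType) (x y : G) : lconj x y = y -> commute x y.
Proof. by rewrite /lconj /commute => e; rewrite -{2}e mulgVK. Qed.

Lemma aut_actK (K L : groupType) (act : K -> L -> L) (k : K) :
  aut_action act -> cancel (act k) (act k^-1).
Proof. by case=> a1 aM _ l; rewrite -aM mulVg a1. Qed.

Lemma aut_actVK (K L : groupType) (act : K -> L -> L) (k : K) :
  aut_action act -> cancel (act k^-1) (act k).
Proof. by case=> a1 aM _ l; rewrite -aM mulgV a1. Qed.

Lemma aut_act_one (K L : groupType) (act : K -> L -> L) (k : K) :
  aut_action act -> act k 1 = 1.
Proof.
case=> _ _ aD; apply: (@mulgI _ (act k 1)).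
by rewrite -aD !mulg1.
Qed.

Lemma aut_actV (K L : groupType) (act : K -> L -> L) (k : K) :
  aut_action act -> {morph act k : l / l^-1}.
Proof.
move=> A l; apply: (@mulgI _ (act k l)).
by rewrite -(aut_act_morph A) !mulgV aut_act_one.
Qed.

Lemma aut_act_lconj (K L : groupType) (act : K -> L -> L) (k : K) (l l' : L) :
  aut_action act -> act k (lconj l l') = lconj (act k l) (act k l').
Proof. by move=> A; rewrite /lconj !(aut_act_morph A) aut_actV. Qed.

(** * Lower central series *)

Lemma lower_central_commute (G : groupType) (n : nat) (x y : G) :
  lower_central_trivial G n.+1 -> lower_central n x -> commute x y.
Proof.
move=> triv xn; apply/commgP/eqP/triv.
by apply: generated_in; exists x, y.
Qed.

Lemma lower_central_comm (G : groupType) (n : nat) (x y : G) :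
  lower_central n x -> lower_central n.+1 [~ x, y].
Proof. by move=> xn; apply: generated_in; exists x, y. Qed.

Lemma lower_central1 (G : groupType) (n : nat) : lower_central n (1 : G).
Proof. by case: n => // n; apply: generated1. Qed.

Lemma lower_centralM (G : groupType) (n : nat) (x y : G) :
  lower_central n x -> lower_central n y -> lower_central n (x * y).
Proof. by case: n => // n; apply: generatedM. Qed.

Lemma lower_centralV (G : groupType) (n : nat) (x : G) :
  lower_central n x -> lower_central n x^-1.
Proof. by case: n => // n; apply: generatedV. Qed.

Lemma has_nil_class_exists (G : groupType) (n : nat) :
  lower_central_trivial G n ->
  exists2 m : nat, (m <= n)%N & has_nil_class G m.
Proof.
move=> trivn.
have exP : exists k, `[< lower_central_trivial G k >].
  by exists n; apply/asboolP.
case: (ex_minnP exP) => m /asboolP trivm minm.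
exists m; first by apply/minm/asboolP.
by split=> // k trivk; apply/minm/asboolP.
Qed.

(** * Generators of presented groups *)

Lemma presented_generated (X : choiceType)
    (R : seq (bool * X) -> seq (bool * X) -> Prop) (t : presented R) :
  generated (fun z => exists x, z = pres_gen R x) t.
Proof.
rewrite -(pres_classK t); elim: (repr t) => [|[b x] w IH].
  exact: generated1.
have -> : pres_class R ((b, x) :: w) =
          (pres_class R [:: (b, x)] : presented R) * pres_class R w.
  by rewrite [RHS]pres_mul_class.
apply: generatedM IH; case: b; last by apply: generated_in; exists x.
have -> : pres_class R [:: (true, x)] = (pres_gen R x : presented R)^-1.
  by rewrite [RHS]pres_inv_class.
by apply: generatedV; apply: generated_in; exists x.
Qed.

(** * The boundaries of a tensor *)

Section Tensor.

Variables (G H : groupType) (aGH : G -> H -> H) (aHG : H -> G -> G).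
Hypotheses (actGH : aut_action aGH) (actHG : aut_action aHG).
Hypothesis compat : compatible_actions aGH aHG.

Local Notation T := (tensor aGH aHG).
Local Notation "g ⊗ h" := (tens aGH aHG g h) (at level 35).

Lemma tensor_generated (t : T) :
  generated (fun z : T => exists g h, z = g ⊗ h) t.
Proof.
elim: (presented_generated t) => [_ [[g h] ->]| |x y _ ? _ ?|x _ ?].
- by apply: generated_in; exists g, h.
- exact: generated1.
- exact: generatedM.
- exact: generatedV.
Qed.

(** With [h'] replaced by its conjugate, compatibility says that the action of
    [^h g] on [H] is that of [g] conjugated by [h]. *)
Lemma compatH (g : G) (h h' : H) :
  aGH (aHG h g) (lconj h h') = lconj h (aGH g h').
Proof.
rewrite compat.1 /lconj; congr (_ * aGH g _ * _).
by rewrite !mulgA mulVg mul1g mulgVK.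
Qed.

Lemma compatG (g g' : G) (h : H) :
  aHG (aGH g h) (lconj g g') = lconj g (aHG h g').
Proof.
rewrite compat.2 /lconj; congr (_ * aHG h _ * _).
by rewrite !mulgA mulVg mul1g mulgVK.
Qed.

(** The two expansions of [g g1 ⊗ h h1], one starting from each defining
    relation, share their outer factors; cancelling these gives the identity
    for [u = ^h g1] and [v = h h1 h^-1]. *)
Lemma tens_swap (g u : G) (h v : H) :
  (lconj g u ⊗ aGH g v) * (g ⊗ h) =
  (g ⊗ h) * (lconj (aHG h g) u ⊗ aGH (aHG h g) v).
Proof.
rewrite -[u](aut_actVK h actHG u) -[v](lconjVK h v).
set g1 := aHG h^-1 u; set h1 := lconj h^-1 v.
have := tensMr aGH aHG (g * g1) h h1.
rewrite (tensMl _ _ _ _ (h * h1)) (tensMl _ _ _ _ h) (aut_act_morph actGH).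
(* The factors are explicit since lconj h h1 itself unfolds to a product. *)
rewrite (tensMr _ _ _ h h1) (tensMr _ _ _ (aGH g h)) (aut_act_morph actHG).
rewrite (tensMl _ _ (aHG h g)) compatG -(aut_act_lconj _ _ _ actGH).
by rewrite -!mulgA => /mulgI; rewrite !mulgA => /mulIg.
Qed.

Definition boundaryG (g : G) (h : H) : G := g * (aHG h g)^-1.
Definition boundaryH (g : G) (h : H) : H := aGH g h * h^-1.

(** This is [tens_swap] with [u] and [v] the images of [g'] and [h'] under
    [(^h g)^-1]. *)
Lemma tens_conj (g g' : G) (h h' : H) :
  lconj (g ⊗ h) (g' ⊗ h') =
  lconj (boundaryG g h) g' ⊗ aGH (boundaryG g h) h'.
Proof.
rewrite lconjM (aut_actM actGH) /lconj -/(lconj _ g').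
apply: (canLR (mulgK _)); rewrite tens_swap lconjVK.
by rewrite (aut_actVK _ actGH).
Qed.

(** As [^h g^-1] acts on [H] as [g^-1] conjugated by [h], the product
    [g * ^h g^-1] acts as [g], [h], [g^-1], [h^-1] composed, the action of [g]
    turning [h] into [^g h]. *)
Lemma boundary_act (g : G) (h h' : H) :
  aGH (boundaryG g h) h' = lconj (boundaryH g h) h'.
Proof.
rewrite (aut_actM actGH) lconjM -(aut_actV _ actHG).
by rewrite -{1}[h'](lconjVK h) compatH (aut_act_lconj _ _ _ actGH)
  (aut_actVK _ actGH).
Qed.

(** The properties of the images of [t] under the boundary maps to [G] and [H]
    on which the argument rests.  A relation suffices: only the existence of
    [a] and [b] matters, so that the boundary maps need not be constructed. *)
Definition boundary (t : T) (a : G) (b : H) : Prop :=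
  (forall g h, lconj t (g ⊗ h) = lconj a g ⊗ aGH a h) /\
  (forall h, aGH a h = lconj b h).

Lemma boundary_tens (g : G) (h : H) :
  boundary (g ⊗ h) (boundaryG g h) (boundaryH g h).
Proof. by split=> [g' h'|h']; [apply: tens_conj | apply: boundary_act]. Qed.

Lemma boundary1 : boundary 1 1 1.
Proof. by split=> [g h|h]; rewrite (aut_act1 actGH) !lconj1. Qed.

Lemma boundaryM t a b t' a' b' :
  boundary t a b -> boundary t' a' b' -> boundary (t * t') (a * a') (b * b').
Proof.
move=> [tT aH] [t'T a'H]; split=> [g h|h]; rewrite (aut_actM actGH) !lconjM.
  by rewrite t'T tT.
by rewrite a'H aH.
Qed.

Lemma boundaryV t a b : boundary t a b -> boundary t^-1 a^-1 b^-1.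
Proof.
move=> [tT aH]; split=> [g h|h].
  apply: (canLR (lconjK t)).
  by rewrite tT lconjVK (aut_actVK _ actGH).
by apply: (canLR (aut_actK a actGH)); rewrite aH lconjVK.
Qed.

Lemma boundaryR t a b t' a' b' :
  boundary t a b -> boundary t' a' b' ->
  boundary [~ t, t'] [~ a, a'] [~ b, b'].
Proof.
move=> tab t'ab; rewrite /commg /conjg.
have tV := boundaryV tab; have t'V := boundaryV t'ab.
exact: boundaryM tV (boundaryM t'V (boundaryM tab t'ab)).
Qed.

Lemma boundary_generated (S : T -> Prop) (n : nat) :
    (forall t, S t -> exists a b,
       [/\ lower_central n a, lower_central n b & boundary t a b]) ->
  forall t, generated S t -> exists a b,
    [/\ lower_central n a, lower_central n b & boundary t a b].
Proof.
move=> SP t; elim=> [x /SP //| |x y _ [a [b [an bn xab]]] _ [a' [b' [a'n b'n yab]]]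
                    |x _ [a [b [an bn xab]]]].
- by exists 1, 1; split; [apply: lower_central1..|apply: boundary1].
- exists (a * a'), (b * b').
  by split; [apply: lower_centralM..|apply: boundaryM].
- by exists a^-1, b^-1; split; [apply: lower_centralV..|apply: boundaryV].
Qed.

Lemma lower_central_boundary (n : nat) (t : T) :
  lower_central n t ->
  exists a b, [/\ lower_central n a, lower_central n b & boundary t a b].
Proof.
have all_bd (s : T) : exists a b,
    [/\ lower_central 0 a, lower_central 0 b & boundary s a b].
  apply: boundary_generated (tensor_generated s) => _ [g [h ->]].
  by exists (boundaryG g h), (boundaryH g h); split=> //; apply: boundary_tens.
elim: n t => [t _|n IH t]; first exact: all_bd.
apply: boundary_generated => _ [x [y [xn ->]]].
have [a [b [an bn xab]]] := IH x xn; have [a' [b' [_ _ yab]]] := all_bd y.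
exists [~ a, a'], [~ b, b'].
by split; [apply: lower_central_comm..|apply: boundaryR].
Qed.

Lemma commute_tensor (t : T) :
  (forall g h, commute t (g ⊗ h)) -> forall s, commute t s.
Proof.
move=> tC s; elim: (tensor_generated s) => [_ [g [h ->]] //| |x y _ ? _ ?|x _ ?].
- exact: commute1.
- exact: commuteM.
- exact: commuteV.
Qed.

Lemma tens11 : 1 ⊗ 1 = 1.
Proof.
have := tensMl aGH aHG 1 1 1; rewrite mulg1 lconj1 (aut_act1 actGH) => e.
by apply: (@mulgI _ (1 ⊗ 1)); rewrite mulg1.
Qed.

Lemma tensor_lower_central_trivial (n : nat) :
  lower_central_trivial G n -> lower_central_trivial H n ->
  lower_central_trivial T n.
Proof.
case: n => [trivG trivH t _|n trivG trivH t].
  (* Class 0: both groups are trivial, so 1 ⊗ 1 is the only generator. *)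
  elim: (tensor_generated t) => [_ [g [h ->]]|//|x y _ -> _ ->|x _ ->].
  - by rewrite (trivG g) // (trivH h) // tens11.
  - exact: mulg1.
  - exact: invg1.
elim=> [_ [x [y [xn ->]]]|//|x y _ -> _ ->|x _ ->]; last 2 first.
- exact: mulg1.
- exact: invg1.
have [a [b [an bn [xT aH]]]] := lower_central_boundary xn.
apply/eqP/commgP; apply: commute_tensor => g h.
apply: commute_lconj; rewrite xT aH.
by rewrite !lconj_id //; apply: lower_central_commute; eassumption.
Qed.

End Tensor.

Theorem proposition3p2 (G H : groupType) (n : nat)
    (aGH : G -> H -> H) (aHG : H -> G -> G)
    (actGH : aut_action aGH) (actHG : aut_action aHG)
    (compat : compatible_actions aGH aHG)
    (nilG : has_nil_class G n) (nilH : has_nil_class H n) :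
  exists2 m : nat, (m <= n)%N & has_nil_class (tensor aGH aHG) m.
Proof.
case: nilG nilH => trivG _ [trivH _].
exact/has_nil_class_exists/tensor_lower_central_trivial.
Qed.
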